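(* A nilpotent dualizable ARN-hypergroup is both Burnside and dual-Burnside.
   Context: ARN-hypergroup (abelian real non-negative hypergroup) $(H,\mathcal B)$: a finite-dimensional commutative unital associative $\mathbb C$-algebra $H$ with a $\mathbb C$-basis $\mathcal B=\{x_1=1,\dots,x_m\}$, $x_ix_j=\sum_kN_{i,j}^kx_k$ with $N_{i,j}^k\in\mathbb R_{\ge0}$, and an involution $i\mapsto i^*$ of $\{1,\dots,m\}$ such that $N_{i,i^*}^1>0$ and $N_{i,j}^1=0$ if $j\ne i^*$. Standing assumption: $x_i\mapsto x_{i^*}$ extends to an anti-involution of $H$, i.e. $N_{i,j}^k=N_{j^*,i^*}^{k^*}$. Put $h_i:=1/N_{i,i^*}^1$. $\mathrm{FPdim}:H\to\mathbb C$ is the unique algebra morphism with positive values on $\mathcal B$; $d_i:=\mathrm{FPdim}(x_i)$. $\widehat{\mathcal B}=\{\mu_1=\mathrm{FPdim},\mu_2,\dots,\mu_m\}$ is the set of all unital algebra morphisms $H\to\mathbb C$, a basis of $H^*$. The dual hypergroup is $H^*$ with basis $\widehat{\mathcal B}$, product $(f\star g)(x_i/d_i)=f(x_i/d_i)g(x_i/d_i)$ for all $i$, unit $\mu_1$, involution $\mu_{j^\#}(x_i)=\mu_j(x_{i^*})$; write $\mu_i\star\mu_j=\sum_k\widehat p_k(i,j)\mu_k$. $(H,\mathcal B)$ is dualizable if its dual is also ARN, i.e. $\widehat p_k(i,j)\ge0$ for all $i,j,k$. $x_i\in\mathcal B$ is grouplike if $x_ix_{i^*}=N_{i,i^*}^1\,1$;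 $\mu_j\in\widehat{\mathcal B}$ is grouplike in the dual if $\mu_j\star\mu_{j^\#}=\widehat p_1(j,j^\#)\mu_1$. Burnside: for every $x_i\in\mathcal B$, there is $\mu\in\widehat{\mathcal B}$ with $\mu(x_i)=0$ if and only if $x_i$ is not grouplike. Dual-Burnside: for every $\mu_j\in\widehat{\mathcal B}$, there is $x_i\in\mathcal B$ with $\mu_j(x_i)=0$ if and only if $\mu_j$ is not grouplike in the dual. A sub-hypergroup is the linear span of a subset of the basis closed under the involution and whose span is a subalgebra. $H_{ad}$ is the sub-hypergroup whose basis consists of all standard elements occurring with non-zero coefficient in some power ($n\ge1$) of $\sum_ih_ix_ix_{i^*}$. Set $H^{(0)}=H$, $H^{(n)}=(H^{(n-1)})_{ad}$ for $n\ge1$. $(H,\mathcal B)$ is nilpotent if $H^{(n)}=\mathbb C$ (the span of the unit) for some $n$. *)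

(* Defs.v *)
From HB Require Import structures.
From mathcomp Require Import all_boot all_order all_algebra all_field.
From mathcomp Require Import boolp reals.
From mathcomp Require Export complex.

Set Implicit Arguments.
Unset Strict Implicit.
Unset Printing Implicit Defensive.

Import Order.TTheory GRing.Theory Num.Theory.
Local Open Scope ring_scope.
Local Open Scope complex_scope.

(* The field of complex numbers is R[i] with R : realType; in its partial     *)
(* order, 0 <= z means that z is real and non-negative. Indices start at 0,   *)
(* so that x_1 = 1 and mu_1 = FPdim are B`_ord0 and mu ord0. The involution   *)
(* i |-> i^* is the function inv.                                             *)

Section Hypergroup.

Variables (R : realType) (H : falgType R[i]) (n : nat).
Variables (B : n.+1.-tuple H) (inv : 'I_n.+1 -> 'I_n.+1).

Definition struct_const (i j k : 'I_n.+1) : R[i] := coord B k (B`_i * B`_j).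

Record ARN_hypergroup : Prop := ARNHypergroup {
  ARN_mulC : commutative (@GRing.mul H);
  ARN_basis : basis_of fullv B;
  ARN_one : B`_(ord0 : 'I_n.+1) = 1;
  ARN_ge0 : forall i j k, 0 <= struct_const i j k;
  ARN_invK : involutive inv;
  ARN_inv_gt0 : forall i, 0 < struct_const i (inv i) ord0;
  ARN_inv_eq0 : forall i j, j != inv i -> struct_const i j ord0 = 0;
  ARN_anti : forall i j k,
    struct_const i j k = struct_const (inv j) (inv i) (inv k)
}.

Definition weight (i : 'I_n.+1) : R[i] := (struct_const i (inv i) ord0)^-1.

Definition grouplike (i : 'I_n.+1) : Prop :=
  B`_i * B`_(inv i) = struct_const i (inv i) ord0 *: 1.

(* 'AHom(H, R[i]^o) is the type of all unital algebra morphisms H -> C.       *)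
Definition burnside : Prop :=
  forall i : 'I_n.+1,
    (exists f : 'AHom(H, R[i]^o), f B`_i = 0) <-> ~ grouplike i.

Definition occurs_in_power (a : H) (k : 'I_n.+1) : Prop :=
  exists2 p : nat, (0 < p)%N & coord B k (a ^+ p) != 0.

(* For the sub-hypergroup L spanned by a subset of B, the standard elements   *)
(* of L are the B`_i lying in L.                                              *)
Definition adjoint (L : {vspace H}) : {vspace H} :=
  let a := \sum_(i < n.+1 | B`_i \in L) weight i *: (B`_i * B`_(inv i)) in
  <<[seq B`_k | k : 'I_n.+1 <- enum 'I_n.+1 &
       `[< occurs_in_power a k >] ]>>%VS.

Definition nilpotent_hypergroup : Prop :=
  exists p : nat, iter p adjoint fullv = 1%VS.

Variable mu : 'I_n.+1 -> 'AHom(H, R[i]^o).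

(* FPdim is characterized by its positivity on B.                             *)
Record dual_enumeration : Prop := DualEnumeration {
  dual_bij : bijective mu;
  dual_FPdim : forall i : 'I_n.+1, 0 < (mu ord0 B`_i : R[i])
}.

Definition dual_tuple : n.+1.-tuple 'Hom(H, R[i]^o) :=
  [tuple ahval (mu k) | k < n.+1].

Definition FPd (i : 'I_n.+1) : R[i] := mu ord0 B`_i.

Definition lin_ext (c : 'I_n.+1 -> R[i]) : 'Hom(H, R[i]^o) :=
  linfun (fun v => \sum_(i < n.+1) coord B i v * c i : R[i]^o).

(* dual_mulE below is the formula that characterizes the product of H^*.      *)
Definition dual_mul (f g : 'Hom(H, R[i]^o)) : 'Hom(H, R[i]^o) :=
  lin_ext (fun i =>
    FPd i * (f ((FPd i)^-1 *: B`_i) * g ((FPd i)^-1 *: B`_i))).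

(* For f = mu_j this is mu_{j^#}; see dual_inv_ahom.                          *)
Definition dual_inv (f : 'Hom(H, R[i]^o)) : 'Hom(H, R[i]^o) :=
  lin_ext (fun i => f B`_(inv i)).

Definition dual_const (i j k : 'I_n.+1) : R[i] :=
  coord dual_tuple k (dual_mul (mu i) (mu j)).

Definition dualizable : Prop := forall i j k, 0 <= dual_const i j k.

(* The scalar is the coefficient of mu_1 in mu_j * mu_{j^#}.                  *)
Definition dual_grouplike (j : 'I_n.+1) : Prop :=
  let f := dual_mul (mu j) (dual_inv (mu j)) in
  f = coord dual_tuple ord0 f *: ahval (mu ord0).

Definition dual_burnside : Prop :=
  forall j : 'I_n.+1,
    (exists i : 'I_n.+1, mu j B`_i = 0) <-> ~ dual_grouplike j.

Section Facts.

Hypotheses (HB : ARN_hypergroup) (Hmu : dual_enumeration).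

Lemma coordB (i j : 'I_n.+1) : coord B i B`_j = (i == j)%:R :> R[i].
Proof. by rewrite coord_free ?(basis_free (ARN_basis HB)) // eq_sym. Qed.

Lemma lin_extE c (j : 'I_n.+1) : lin_ext c B`_j = c j.
Proof.
pose F (v : H) : R[i]^o := \sum_i coord B i v * c i.
have lin : linear F.
  move=> a u v; rewrite /F scaler_sumr -big_split; apply: eq_bigr => i _ /=.
  by rewrite linearP mulrDl /GRing.scale /= mulrA.
pose F' : {linear H -> R[i]^o} :=
  HB.pack F (GRing.isLinear.Build _ _ _ _ F lin).
rewrite -[LHS]/(linfun F' B`_j) lfunE /= /F.
rewrite (bigD1 j) //= coordB eqxx mul1r big1 ?addr0 // => i ne.
by rewrite coordB (negPf ne) mul0r.
Qed.

Lemma dual_mulE f g (i : 'I_n.+1) :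
  dual_mul f g ((FPd i)^-1 *: B`_i) =
  f ((FPd i)^-1 *: B`_i) * g ((FPd i)^-1 *: B`_i).
Proof.
rewrite [LHS]linearZ /= lin_extE /GRing.scale /= mulrA mulVf ?mul1r //.
by rewrite gt_eqF // (dual_FPdim Hmu).
Qed.

Lemma dual_invE f (i : 'I_n.+1) : dual_inv f B`_i = f B`_(inv i).
Proof. exact: lin_extE. Qed.

Lemma coord_sumB v : v = \sum_(i < n.+1) coord B i v *: B`_i.
Proof. by apply: coord_basis (ARN_basis HB) _; rewrite memvf. Qed.

Lemma ahom_mul (f : 'AHom(H, R[i]^o)) u v : f (u * v) = f u * f v.
Proof. exact: rmorphM. Qed.

Lemma ahom1 (f : 'AHom(H, R[i]^o)) : f 1 = 1.
Proof. exact: rmorph1. Qed.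

Lemma inv0 : inv ord0 = ord0.
Proof.
apply/eqP; rewrite eq_sym; apply/negPn/negP => ne.
have := ARN_inv_eq0 HB ne; rewrite /struct_const (ARN_one HB) mulr1.
by rewrite -(ARN_one HB) coordB eqxx => /eqP; rewrite oner_eq0.
Qed.

Lemma dual_invM (f : 'AHom(H, R[i]^o)) u v :
  dual_inv f (u * v) = dual_inv f u * dual_inv f v.
Proof.
have base (i j : 'I_n.+1) :
    dual_inv f (B`_i * B`_j) = dual_inv f B`_i * dual_inv f B`_j.
  rewrite !dual_invE -ahom_mul (ARN_mulC HB B`_(inv i)).
  rewrite [B`_i * _]coord_sumB [B`_(inv j) * _]coord_sumB !linear_sum /=.
  rewrite [RHS](reindex_inj (inv_inj (ARN_invK HB))) /=.
  apply: eq_bigr => k _; rewrite !linearZ /= dual_invE.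
  congr (_ *: _); exact: ARN_anti.
rewrite (coord_sumB u) (coord_sumB v) mulr_suml !linear_sum mulr_suml /=.
apply: eq_bigr => i _; rewrite !mulr_sumr linear_sum /=.
apply: eq_bigr => j _.
by rewrite -scalerAl -scalerAr !linearZ /= base -scalerAl -scalerAr.
Qed.

Lemma dual_inv_ahom j : exists k, ahval (mu k) = dual_inv (mu j).
Proof.
have h : ahom_in {:H} (dual_inv (mu j)).
  apply/ahom_inP; split=> [u v _ _|]; first exact: dual_invM.
  by rewrite -(ARN_one HB) dual_invE inv0 (ARN_one HB) ahom1.
by case: (dual_bij Hmu) => g _ gK; exists (g (AHom h)); rewrite gK.
Qed.

Lemma dual_separate j k : j != k -> exists v, mu j v = 0 /\ mu k v = 1.
Proof.
move=> ne; have [i nei] : exists i : 'I_n.+1, mu j B`_i != mu k B`_i.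
  apply/existsP; apply: contraNT ne; rewrite negb_exists => /forallP E.
  rewrite -(bij_eq (dual_bij Hmu)) -val_eqE /=; apply/eqP/lfunP => v.
  rewrite (coord_sumB v) !linear_sum /=; apply: eq_bigr => i _.
  by rewrite !linearZ /=; have /negPn/eqP -> := E i.
have nz : (mu k B`_i - mu j B`_i : R[i]) != 0 by rewrite subr_eq0 eq_sym.
set a : R[i] := mu j B`_i; set b : R[i] := mu k B`_i in nz *.
exists ((b - a)^-1 *: (B`_i - a *: 1)).
have E (f : 'AHom(H, R[i]^o)) :
    f ((b - a)^-1 *: (B`_i - a *: 1)) = (b - a)^-1 * (f B`_i - a) :> R[i].
  rewrite [LHS]linearZ /=; congr (_ * _); rewrite raddfB; congr (_ - _).
  by rewrite [LHS]linearZ /= ahom1; exact: mulr1.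
by rewrite !E subrr mulr0 mulVf.
Qed.

Lemma dual_idempotent k : exists e, forall j, mu j e = (j == k)%:R :> R[i].
Proof.
have ex j : exists v, mu k v = 1 /\ (j != k -> mu j v = 0).
  case: (eqVneq j k) => [_|/dual_separate[v [v0 v1]]].
    by exists 1; split => //; exact: ahom1.
  by exists v.
have [w wP] := choice ex.
exists (\prod_j w j) => j; rewrite rmorph_prod /=; case: eqVneq => [->|ne].
  by rewrite big1 // => l _; case: (wP l).
pose z : R[i] := \prod_(l | l != j) mu j (w l).
have -> : \prod_l mu j (w l) = mu j (w j) * z :> R[i] by rewrite (bigD1 j).
by rewrite (proj2 (wP j) ne) mul0r.
Qed.

Lemma dual_tuple_basis : basis_of fullv dual_tuple.
Proof.
have fr : free dual_tuple.
  apply/freeP => c c0 k; have [e eP] := dual_idempotent k.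
  have := congr1 (fun f : 'Hom(H, R[i]^o) => f e : R[i]) c0.
  rewrite sum_lfunE lfunE /= (bigD1 k) //= big1 => [|j ne].
    by rewrite addr0 scale_lfunE nth_mktuple eP eqxx /GRing.scale /= mulr1.
  by rewrite scale_lfunE nth_mktuple eP (negPf ne) scaler0.
rewrite basisEfree fr subvf size_tuple dimvf.
have := size_basis (ARN_basis HB); rewrite dimvf => <-.
by rewrite /dim /= muln1.
Qed.

End Facts.

End Hypergroup.

(* Main.v *)
(* Let t(x, mu) = mu(x) / FPdim(x). Dualizability makes the table t and its
   transpose tables of the same kind, so one vanishing statement, applied to
   both, gives both Burnside properties: if a chain of closed subsets starts
   with the whole basis, ends with the unit, and contains the constituents of
   x x^* one step further down for every x, then a column without zeros is
   unimodular, i.e. grouplike. The iterated adjoint sub-hypergroups are such a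
   chain for the rows, and their annihilators, in the opposite order, are one
   for the columns. The vanishing statement climbs the chain: if mu is
   unimodular on one term, every constituent nu of mu * mu^# is 1 there, hence
   unimodular on the previous term S; then conj(nu) mu is a character of S
   containing, and thus equal to, mu, so that nu = 1 on S wherever mu <> 0. *)

Require Import Defs.
From mathcomp Require Import all_boot all_order all_algebra all_field.
From mathcomp Require Import boolp reals ring.

Set Implicit Arguments.
Unset Strict Implicit.
Unset Printing Implicit Defensive.

Import Order.TTheory GRing.Theory Num.Theory.

Local Open Scope ring_scope.

(** Expanding the squares turns the weighted variance \sum_l p_l |z_l - u|^2 into \sum_l p_l
    (|z_l|^2 - 1), which is at most 0, so each of its non-negative terms vanishes. *)
Lemma convex_extremal (C : numClosedFieldType) (I : finType)
    (p z : I -> C) (u : C) :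
  (forall l, 0 <= p l) -> \sum_l p l = 1 -> (forall l, `|z l| <= 1) ->
  `|u| = 1 -> \sum_l p l * z l = u -> forall l, p l != 0 -> z l = u.
Proof.
move=> p0 p1 z1 u1 zu.
have uu : u * u^* = 1 by rewrite -normCK u1 expr1n.
have E l : p l * `|z l - u| ^+ 2
    = p l * (`|z l| ^+ 2 - 1) + p l * 2 - p l * z l * u^* - (p l * z l)^* * u.
  rewrite !normCK rmorphB rmorphM /= (CrealP (ger0_real (p0 l))).
  rewrite mulrBl !mulrBr uu; ring.
have S0 : \sum_l p l * `|z l - u| ^+ 2 <= 0.
  under eq_bigr => l _ do rewrite E.
  rewrite !sumrB big_split /= -!mulr_suml -rmorph_sum /= p1 zu uu.
  rewrite mulrC [_^* * _]mulrC uu [X in X <= _](_ : _ =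
    \sum_l p l * (`|z l| ^+ 2 - 1)); last by ring.
  apply: sumr_le0 => l _; apply: mulr_ge0_le0 => //.
  by rewrite subr_le0 expr_le1.
have P0 l : 0 <= p l * `|z l - u| ^+ 2 by rewrite mulr_ge0 ?exprn_ge0.
have {}S0 : \sum_l p l * `|z l - u| ^+ 2 = 0.
  by apply/le_anti; rewrite S0 sumr_ge0.
move=> l pl; apply/eqP; rewrite -subr_eq0 -normr_eq0 -sqrf_eq0.
have /eqP := S0; rewrite psumr_eq0 // => /allP/(_ l (mem_index_enum l)) /=.
by rewrite mulf_eq0 (negPf pl).
Qed.

(** * Tables of normalized characters *)

Section Reciprocity.

Variables (C : numClosedFieldType) (I : finType).
Variables (star : I -> I) (w : I -> C) (N : I -> I -> I -> C).

(* Both sides are, up to a factor symmetric in k and l, the coefficient of the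
   unit in x_(l^* ) x_i x_k. *)
Definition reciprocal :=
  forall i k l, w k * N i k l = w l * N (star l) i (star k).

Definition sub_closed (S : pred I) :=
  (forall i, S i -> S (star i)) /\
  (forall i k l, S i -> S k -> N i k l != 0 -> S l).

Definition multiplicative_on (S : pred I) (f : I -> C) :=
  forall i k, S i -> S k -> f i * f k = \sum_l N i k l * f l.

(* Reciprocity says that \sum_k w_k x_k (x) x_(k^* ) is a Casimir element. *)
Lemma character_orthogonality (S : pred I) (f g : I -> C) :
  involutive star -> reciprocal -> sub_closed S ->
  multiplicative_on S f -> multiplicative_on S g ->
  \sum_(k | S k) w k * f k * g (star k) != 0 -> {in S, f =1 g}.
Proof.
move=> starK rec [Sstar SM] fM gM nz i Si; apply: (mulIf nz).
have sumS (h : I -> C) a b : S a -> S b ->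
    \sum_l N a b l * h l = \sum_(l | S l) N a b l * h l.
  move=> Sa Sb; rewrite [RHS]big_mkcond /=; apply: eq_bigr => l _.
  case: ifPn => // Sl; case: (eqVneq (N a b l) 0) => [->|ne]; rewrite ?mul0r//.
  by rewrite (SM _ _ _ Sa Sb ne) in Sl.
rewrite !mulr_sumr.
(* Multiplicativity of [f] absorbs the factor [f i]; reciprocity then moves the index [i] to the
   side of [g]. *)
transitivity (\sum_(k | S k) \sum_(l | S l)
    w l * N (star l) i (star k) * f l * g (star k)).
  apply: eq_bigr => k Sk.
  rewrite mulrA mulrCA fM // sumS // mulr_sumr mulr_suml.
  by apply: eq_bigr => l _; rewrite mulrA rec.
rewrite exchange_big /=; apply: eq_bigr => l Sl.
rewrite [RHS](_ : _ = w l * f l * (g (star l) * g i)); last by ring.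
have star_inj := inv_inj starK.
rewrite gM ?Sstar // sumS ?Sstar // mulr_sumr [RHS](reindex_inj star_inj) /=.
apply: eq_big => [k|k _]; last by ring.
by apply/idP/idP => /Sstar; rewrite ?starK.
Qed.

End Reciprocity.

(* In the table t of normalized character values, the rows are the normalized
   basis elements and the columns the characters. *)
Record character_table (C : numClosedFieldType) (I J : finType) (o : I) (u : J)
    (star : I -> I) (w : I -> C) (N : I -> I -> I -> C) (t : I -> J -> C) :
    Prop := CharacterTable {
  table_starK : involutive star;
  table_gt0 : forall i, 0 < w i;
  table_ge0 : forall i k l, 0 <= N i k l;
  table_rec : reciprocal star w N;
  table_one : forall j, t o j = 1;
  table_unit : forall i, t i u = 1;
  table_mul : forall i k j, t i j * t k j = \sum_l N i k l * t l j;
  table_conj : forall i j, t (star i) j = (t i j)^*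
}.

Section Table.

Variables (C : numClosedFieldType) (I J : finType) (o : I) (u : J).
Variables (star : I -> I) (w : I -> C) (N : I -> I -> I -> C) (t : I -> J -> C).
Hypothesis T : character_table o u star w N t.

Lemma table_sum1 i k : \sum_l N i k l = 1.
Proof.
have := table_mul T i k u; rewrite !(table_unit T) mulr1 => ->.
by apply: eq_bigr => l _; rewrite (table_unit T) mulr1.
Qed.

(* By reciprocity the weights w form a measure invariant under convolution. *)
Lemma table_norm_le1 i j : `|t i j| <= 1.
Proof.
have Agt0 : 0 < \sum_k w k * `|t k j|.
  rewrite (bigD1 o) //= (table_one T) normr1 mulr1 ltr_wpDr ?(table_gt0 T) //.
  by apply: sumr_ge0 => k _; rewrite mulr_ge0 ?(ltW (table_gt0 T _)).
rewrite -(ler_pM2r Agt0) mul1r mulr_sumr.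
apply: (@le_trans _ _ (\sum_k \sum_l w l * N (star l) i (star k) * `|t l j|)).
  apply: ler_sum => k _; rewrite mulrCA -normrM (table_mul T).
  apply: le_trans (_ : w k * \sum_l N i k l * `|t l j| <= _).
    rewrite ler_pM2l ?(table_gt0 T) //; apply: le_trans (ler_norm_sum _ _ _) _.
    by apply: ler_sum => l _; rewrite normrM (ger0_norm (table_ge0 T _ _ _)).
  by rewrite mulr_sumr; apply: ler_sum => l _; rewrite mulrA (table_rec T).
rewrite exchange_big /=; apply: ler_sum => l _.
rewrite -mulr_suml -mulr_sumr.
have -> : \sum_k N (star l) i (star k) = 1.
  rewrite -[RHS](table_sum1 (star l) i).
  by rewrite [RHS](reindex_inj (inv_inj (table_starK T))).
by rewrite mulr1.
Qed.

Lemma table_normE i j : `|t i j| ^+ 2 = \sum_l N i (star i) l * t l j.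
Proof. by rewrite normCK -(table_conj T) (table_mul T). Qed.

(** The number |t i j|^2 = 1 is a convex combination of values in the unit disc, so
    [convex_extremal] applies with u = 1. *)
Lemma table_constituents_unit i j :
  `|t i j| = 1 -> forall l, N i (star i) l != 0 -> t l j = 1.
Proof.
move=> n1; apply: (@convex_extremal _ _ (N i (star i)) (t ^~ j)).
- by move=> l; apply: (table_ge0 T).
- exact: table_sum1.
- by move=> l; apply: table_norm_le1.
- exact: normr1.
- by rewrite -table_normE n1 expr1n.
Qed.

Lemma table_norm1 i j :
  (forall l, N i (star i) l != 0 -> t l j = 1) -> `|t i j| = 1.
Proof.
move=> H; apply/eqP; rewrite -(@pexpr_eq1 _ _ 2) ?normr_ge0 //; apply/eqP.
rewrite table_normE -[RHS](table_sum1 i (star i)); apply: eq_bigr => l _.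
by case: (eqVneq (N i (star i) l) 0) => [->|/H->]; rewrite ?mul0r ?mulr1.
Qed.

Lemma table_unimodular_mul i k j l :
  `|t i j| = 1 -> `|t k j| = 1 -> N i k l != 0 -> t l j = t i j * t k j.
Proof.
move=> ti tk; apply: (@convex_extremal _ _ (N i k) (t ^~ j)).
- by move=> m; apply: (table_ge0 T).
- exact: table_sum1.
- by move=> m; apply: table_norm_le1.
- by rewrite normrM ti tk mulr1.
- by rewrite (table_mul T).
Qed.

(** An inclusion rather than an equality, since this is the form that passes to annihilators. *)
Definition table_ad (S S' : pred I) :=
  forall i l, S i -> N i (star i) l != 0 -> S' l.

End Table.

Definition table_perp (C : numClosedFieldType) (I J : finType) (t : I -> J -> C)
  (S : pred I) : pred J := fun j => [forall (i | S i), t i j == 1].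

(** * Annihilators and descent for a table and its transpose *)

Section DualTables.

Variables (C : numClosedFieldType) (I J : finType) (o : I) (u : J).
Variables (star : I -> I) (w : I -> C) (N : I -> I -> I -> C).
Variables (star' : J -> J) (w' : J -> C) (N' : J -> J -> J -> C).
Variable t : I -> J -> C.
Hypothesis T : character_table o u star w N t.
Hypothesis T' : character_table u o star' w' N' (fun j i => t i j).

Lemma table_perpP (S : pred I) j :
  reflect (forall i, S i -> t i j = 1) (table_perp t S j).
Proof. exact: 'forall_in_eqP. Qed.

(** The value 1 is extremal, so each constituent of a product of two characters equal to 1 at [i] is
    again 1 at [i]. *)
Lemma perp_closed S : sub_closed star' N' (table_perp t S).
Proof.
split=> [j /table_perpP Sj | j k l /table_perpP Sj /table_perpP Sk nz].
  by apply/table_perpP => i Si; rewrite (table_conj T') Sj // rmorph1.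
apply/table_perpP => i Si.
rewrite (table_unimodular_mul T' (l := l) (i := j) (k := k)) ?Sj ?Sk ?normr1 //.
by rewrite mulr1.
Qed.

(** For x in S, a character equal to 1 on the constituents of x x^* is unimodular at x. Read in the
    transpose, this forces the constituents of mu_j * mu_j^# to be 1 at x. *)
Lemma perp_ad S S' :
  table_ad star N S S' ->
  table_ad star' N' (table_perp t S') (table_perp t S).
Proof.
move=> ad j l /table_perpP Sj nz; apply/table_perpP => i Si.
apply: (table_constituents_unit T' (i := j)) nz.
by apply: (table_norm1 T) => m nm; apply/Sj/(ad _ _ Si).
Qed.

(* If mu_l occurs in mu_j * mu_j^#, then t(., l) is unimodular on S, so
   x |-> conj(t(x, l)) t(x, j) is a character of S; it contains t(., j) by
   reciprocity, hence equals it, and t(., l) = 1 wherever t(., j) <> 0. *)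
Lemma unimodular_descent (S S' : pred I) j :
  sub_closed star N S -> table_ad star N S S' -> (forall i, t i j != 0) ->
  (forall i, S' i -> `|t i j| = 1) -> forall i, S i -> `|t i j| = 1.
Proof.
move=> Scl ad nz S'1.
suff key l : N' j (star' j) l != 0 -> forall i, S i -> t i l = 1.
  by move=> i Si; apply: (table_norm1 T') => l /key; apply.
move=> pl i0 Si0; pose l' := star' l.
have lS' i : S' i -> t i l = 1.
  by move=> Si; apply: (table_constituents_unit T' (S'1 i Si)).
have lS i : S i -> `|t i l'| = 1.
  move=> Si; rewrite (table_conj T') norm_conjC; apply: (table_norm1 T) => m nm.
  exact/lS'/(ad _ _ Si).
pose f i := t i l' * t i j.
have tM q : multiplicative_on N S (t ^~ q).
  by move=> i k _ _; apply: (table_mul T).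
(* Unimodularity makes t(., l') constant on the constituents of a product in S, so twisting by it
   preserves multiplicativity. *)
have fM : multiplicative_on N S f.
  move=> i k Si Sk; rewrite /f mulrACA (table_mul T i k j) mulr_sumr.
  apply: eq_bigr => m _; case: (eqVneq (N i k m) 0) => [->|nm].
    by rewrite !mul0r mulr0.
  by rewrite (table_unimodular_mul T (lS _ Si) (lS _ Sk) nm) mulrCA.
have orth q g := @character_orthogonality _ _ _ _ _ S g (t ^~ q)
  (table_starK T) (table_rec T) Scl ^~ (tM q).
have sq_ge0 i q : 0 <= w i * t i q * t (star i) q.
  rewrite (table_conj T) -mulrA -normCK.
  by rewrite mulr_ge0 ?exprn_ge0 // ltW ?(table_gt0 T).
have pos : 0 < \sum_(i | S i) w i * t i j * t (star i) j.
  rewrite (bigD1 i0) //= ltr_wpDr ?sumr_ge0 // lt0r sq_ge0 andbT.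
  by rewrite !mulf_neq0 // gt_eqF // (table_gt0 T).
(* Two characters of S are orthogonal or equal; in the second case the sum is a squared norm. *)
have term q : 0 <= \sum_(i | S i) w i * t i q * t (star i) j.
  have [->//|/(orth j (t ^~ q) (tM q)) E] :=
    eqVneq (\sum_(i | S i) w i * t i q * t (star i) j) 0.
  by apply: sumr_ge0 => i Si; rewrite /= (E i Si) sq_ge0.
have fj : {in S, f =1 t ^~ j}.
  apply: (orth j f fM); rewrite gt_eqF //.
  have -> : \sum_(i | S i) w i * f i * t (star i) j = \sum_q N' l' j q *
      \sum_(i | S i) w i * t i q * t (star i) j.
    under [RHS]eq_bigr => q _ do rewrite mulr_sumr.
    rewrite exchange_big /=; apply: eq_bigr => i _.
    rewrite /f (table_mul T' l' j i) mulr_sumr mulr_suml.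
    by apply: eq_bigr => q _; rewrite !mulrA [w i * _]mulrC.
  (* Reciprocity in the transpose: mu_l occurs in mu_j * mu_j^# exactly when mu_j occurs in mu_l^# *
     mu_j. *)
  have p' : 0 < N' l' j j.
    rewrite lt0r (table_ge0 T') andbT; apply: contraNneq pl => E.
    have := table_rec T' j (star' j) l; rewrite (table_starK T') E mulr0.
    by move=> /eqP; rewrite mulf_eq0 gt_eqF ?(table_gt0 T').
  rewrite (bigD1 j) //= ltr_wpDr ?mulr_gt0 //.
  by apply: sumr_ge0 => q _; rewrite mulr_ge0 ?(table_ge0 T').
have := fj i0 Si0; rewrite /f /= -[RHS]mul1r => /(mulIf (nz i0)).
rewrite (table_conj T') => /(congr1 Num.conj); rewrite conjCK => ->.
exact: rmorph1.
Qed.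

Lemma nilpotent_unimodular (F : nat -> pred I) (p : nat) j :
  (forall k, sub_closed star N (F k)) ->
  (forall k, (k < p)%N -> table_ad star N (F k) (F k.+1)) ->
  (forall i, F p i -> `|t i j| = 1) -> (forall i, t i j != 0) ->
  forall i, F 0%N i -> `|t i j| = 1.
Proof.
move=> Fcl Fad Fp nz.
suff H k : (k <= p)%N -> forall i, F (p - k)%N i -> `|t i j| = 1.
  by have := H p (leqnn p); rewrite subnn.
elim: k => [|k IH] kp; first by rewrite subn0.
have E : (p - k = (p - k.+1).+1)%N by rewrite subnSK.
apply: (unimodular_descent (S' := F (p - k)%N)) => //; last exact/IH/ltnW.
by rewrite E; apply: Fad; rewrite -E leq_subr.
Qed.

End DualTables.

(** * The tables of a dualizable hypergroup *)

Local Open Scope complex_scope.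

Section Hypergroup.

Variables (R : realType) (H : falgType R[i]) (n : nat).
Variables (B : n.+1.-tuple H) (inv : 'I_n.+1 -> 'I_n.+1).
Hypothesis HB : ARN_hypergroup B inv.

Local Notation s := (struct_const B).
Local Notation h := (weight B inv).

Lemma coord_mul (v w : H) l :
  coord B l (v * w) = \sum_i \sum_k coord B i v * coord B k w * s i k l.
Proof.
rewrite {1}(coord_sumB HB v) {1}(coord_sumB HB w) mulr_suml linear_sum.
apply: eq_bigr => i _; rewrite mulr_sumr linear_sum; apply: eq_bigr => k _ /=.
by rewrite -scalerAl -scalerAr !linearZ /= mulrA.
Qed.

Lemma struct_const_sym i k l : s i k l = s k i l.
Proof. by rewrite /struct_const (ARN_mulC HB). Qed.

Lemma coord0_mul (v : H) (k : 'I_n.+1) :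
  coord B ord0 (v * B`_k) = coord B (inv k) v * s (inv k) k ord0.
Proof.
rewrite {1}(coord_sumB HB v) mulr_suml linear_sum (bigD1 (inv k)) //= big1.
  by rewrite addr0 -scalerAl linearZ.
move=> i ne; rewrite -scalerAl linearZ /= -/(s i k ord0).
rewrite (ARN_inv_eq0 HB) ?mulr0 //.
by apply: contraNneq ne => ->; rewrite (ARN_invK HB).
Qed.

Lemma weight_gt0 i : 0 < h i.
Proof. by rewrite invr_gt0 (ARN_inv_gt0 HB). Qed.

Lemma struct_const_reciprocal : reciprocal inv h s.
Proof.
move=> i k l.
have e : coord B ord0 (B`_i * B`_k * B`_(inv l))
  = coord B ord0 (B`_(inv l) * B`_i * B`_k).
  by rewrite (ARN_mulC HB _ B`_(inv l)) mulrA.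
rewrite !coord0_mul (ARN_invK HB) (struct_const_sym (inv k)) in e.
have nz a : s a (inv a) ord0 != 0 by rewrite gt_eqF // (ARN_inv_gt0 HB).
rewrite /weight; apply: (mulfI (nz k)); apply: (mulIf (nz l)).
rewrite mulVKf // [RHS](_ : _ = (s l (inv l) ord0)^-1 * s l (inv l) ord0 *
  (s (inv l) i (inv k) * s k (inv k) ord0)); last by ring.
by rewrite mulVf // mul1r.
Qed.

Lemma ahom_scale (f : 'AHom(H, R[i]^o)) (c : R[i]) v :
  f (c *: v) = c * f v :> R[i].
Proof. by rewrite [LHS]linearZ. Qed.

Lemma character_mul (f : 'AHom(H, R[i]^o)) (i k : 'I_n.+1) :
  (f B`_i * f B`_k : R[i]) = \sum_l s i k l * f B`_l.
Proof.
rewrite -[LHS]ahom_mul (coord_sumB HB (B`_i * _)) linear_sum.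
by apply: eq_bigr => l _; rewrite [LHS]ahom_scale.
Qed.

(* The conjugate of the character x_i |-> f x_(i^* ) has a non-zero
   inner product with f. *)
Lemma character_conj (f : 'AHom(H, R[i]^o)) (i : 'I_n.+1) :
  f B`_(inv i) = Num.conj (f B`_i : R[i]) :> R[i].
Proof.
pose F (k : 'I_n.+1) : R[i] := f B`_k.
pose G k : R[i] := Num.conj (F (inv k)).
suff E : F (inv i) = G (inv i) by rewrite -/(F _) E /G (ARN_invK HB).
apply: (@character_orthogonality _ _ inv h s predT F G) => //.
- exact: (ARN_invK HB).
- exact: struct_const_reciprocal.
- by move=> a b _ _; apply: character_mul.
- move=> a b _ _; rewrite /G -rmorphM character_mul.
  rewrite (reindex_inj (inv_inj (ARN_invK HB))) rmorph_sum /=.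
  apply: eq_bigr => l _; rewrite rmorphM /=; congr (_ * _).
  rewrite (CrealP (ger0_real (ARN_ge0 HB _ _ _))).
  by rewrite -(ARN_anti HB) struct_const_sym.
have term k : 0 <= h k * F k * G (inv k).
  rewrite /G (ARN_invK HB) -mulrA -normCK.
  by rewrite mulr_ge0 ?exprn_ge0 // ltW ?weight_gt0.
rewrite gt_eqF // (bigD1 ord0) //= ltr_wpDr ?sumr_ge0 // lt0r term andbT.
have F1 : F ord0 = 1 by rewrite /F (ARN_one HB) ahom1.
rewrite /G !(Defs.inv0 HB) F1 rmorph1 !mulr1.
by rewrite gt_eqF ?weight_gt0.
Qed.

(** * Adjoint sub-hypergroups as sets of indices *)

Lemma mem_span_basis (P : pred 'I_n.+1) (i : 'I_n.+1) :
  (B`_i \in <<[seq B`_k | k : 'I_n.+1 <- enum 'I_n.+1 & P k]>>%VS) = P i.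
Proof.
apply/idP/idP => [|Pi]; last first.
  by apply/memv_span/map_f; rewrite mem_filter Pi mem_enum.
move=> Bi; apply/negPn/negP => nP.
(* The [i]-th coordinate kills every generator of the span but not B_i. *)
pose c : 'Hom(H, R[i]^o) := linfun (coord B i : H -> R[i]^o).
have /subvP/(_ _ Bi) : (<<[seq B`_k | k : 'I_n.+1 <- enum 'I_n.+1 & P k]>>
    <= lker c)%VS.
  apply/span_subvP => _ /mapP[k + ->]; rewrite mem_filter => /andP[Pk _].
  rewrite memv_ker lfunE /= (coordB HB).
  case: (eqVneq i k) => [e|_]; last exact: eqxx.
  by rewrite -e (negPf nP) in Pk.
by rewrite memv_ker lfunE /= (coordB HB) eqxx oner_eq0.
Qed.

Definition indices (L : {vspace H}) : pred 'I_n.+1 := fun i => B`_i \in L.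

Definition adjoint_gen (L : {vspace H}) : H :=
  \sum_(i < n.+1 | B`_i \in L) h i *: (B`_i * B`_(inv i)).

Lemma indices_adjoint L i :
  indices (adjoint B inv L) i = `[< occurs_in_power B (adjoint_gen L) i >].
Proof. exact: mem_span_basis. Qed.

Lemma coord_adjoint_gen L l : coord B l (adjoint_gen L) =
  \sum_(i < n.+1 | B`_i \in L) h i * s i (inv i) l.
Proof. by rewrite linear_sum; apply: eq_bigr => i _; rewrite linearZ. Qed.

(** Non-negativity excludes cancellation: one positive term suffices for a basis element to
    occur. *)
Lemma adjoint_gen_coord_ge0 L p l : 0 <= coord B l (adjoint_gen L ^+ p).
Proof.
elim: p l => [|p IH] l.
  by rewrite expr0 -(ARN_one HB) (coordB HB) ler0n.
rewrite exprS coord_mul; apply: sumr_ge0 => i _; apply: sumr_ge0 => k _.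
rewrite !mulr_ge0 // ?(ARN_ge0 HB) // coord_adjoint_gen.
by apply: sumr_ge0 => a _; rewrite mulr_ge0 ?(ARN_ge0 HB) // ltW ?weight_gt0.
Qed.

(** Each x x^* is fixed by the anti-involution, hence so are the generator and, by commutativity,
    its powers. *)
Lemma adjoint_gen_coord_inv L p l :
  coord B (inv l) (adjoint_gen L ^+ p) = coord B l (adjoint_gen L ^+ p).
Proof.
have g1 k : coord B (inv k) (adjoint_gen L) = coord B k (adjoint_gen L).
  rewrite !coord_adjoint_gen; apply: eq_bigr => a _; congr (_ * _).
  by rewrite (ARN_anti HB) !(ARN_invK HB).
elim: p l => [|p IH] l.
  rewrite expr0 -(ARN_one HB) !(coordB HB) -{1}(Defs.inv0 HB).
  by rewrite (inj_eq (inv_inj (ARN_invK HB))).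
rewrite exprS !coord_mul.
rewrite (reindex_inj (inv_inj (ARN_invK HB))); apply: eq_bigr => i _ /=.
rewrite (reindex_inj (inv_inj (ARN_invK HB))); apply: eq_bigr => k _ /=.
by rewrite g1 IH -(ARN_anti HB) struct_const_sym.
Qed.

(** If B_i occurs in a^p and B_k in a^q, the constituents of B_i B_k occur in a^(p+q), as nothing
    cancels. *)
Lemma indices_adjoint_closed L :
  sub_closed inv s (indices (adjoint B inv L)).
Proof.
split=> [i|i k l]; rewrite !indices_adjoint.
  move=> /asboolP[p p0 nz]; apply/asboolP; exists p => //.
  by rewrite adjoint_gen_coord_inv.
move=> /asboolP[p p0 nzp] /asboolP[q q0 nzq] nz; apply/asboolP.
exists (p + q)%N; first by rewrite addn_gt0 p0.
have pos a b : 0 <= coord B a (adjoint_gen L ^+ p) *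
    coord B b (adjoint_gen L ^+ q) * s a b l.
  by rewrite !mulr_ge0 ?adjoint_gen_coord_ge0 ?(ARN_ge0 HB).
rewrite exprD coord_mul gt_eqF // (bigD1 i) //= ltr_wpDr //.
  by apply: sumr_ge0 => a _; apply: sumr_ge0.
rewrite (bigD1 k) //= ltr_wpDr ?sumr_ge0 // lt0r pos andbT.
by rewrite !mulf_neq0.
Qed.

Lemma indices_iter_closed p :
  sub_closed inv s (indices (iter p (adjoint B inv) fullv)).
Proof.
case: p => [|p]; last exact: indices_adjoint_closed.
by split=> *; rewrite /indices memvf.
Qed.

Lemma indices_ad L :
  table_ad inv s (indices L) (indices (adjoint B inv L)).
Proof.
move=> i l Li nz; rewrite indices_adjoint; apply/asboolP; exists 1%N => //.
rewrite expr1 coord_adjoint_gen gt_eqF // (bigD1 i) //=.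
rewrite ltr_wpDr ?mulr_gt0 ?weight_gt0 //; last by rewrite lt0r nz (ARN_ge0 HB).
by apply: sumr_ge0 => a _; rewrite mulr_ge0 ?(ARN_ge0 HB) // ltW ?weight_gt0.
Qed.

Lemma indices_1 i : indices 1%VS i -> i = ord0.
Proof.
move=> /vlineP[c E]; have := coordB HB i i.
rewrite E eqxx linearZ /= -(ARN_one HB) (coordB HB).
case: (eqVneq i ord0) => // _; rewrite mulr0 => /eqP.
by rewrite eq_sym oner_eq0.
Qed.

(** * The normalized character table and its transpose *)

Variable mu : 'I_n.+1 -> 'AHom(H, R[i]^o).
Hypothesis Hmu : dual_enumeration B mu.
Hypothesis Hdual : dualizable B mu.

Local Notation d := (FPd B mu).

Lemma FPd_gt0 i : 0 < d i.
Proof. exact: (dual_FPdim Hmu). Qed.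

Lemma FPd_neq0 i : d i != 0.
Proof. by rewrite gt_eqF ?FPd_gt0. Qed.

Lemma FPd_inv i : d (inv i) = d i.
Proof.
by rewrite /FPd character_conj; apply/CrealP/gtr0_real; apply: FPd_gt0.
Qed.

Definition normalized_table (i j : 'I_n.+1) : R[i] := mu j B`_i / d i.
Local Notation t := normalized_table.

Lemma characterE (i j : 'I_n.+1) : mu j B`_i = d i * t i j :> R[i].
Proof. by rewrite mulrC divfK ?FPd_neq0. Qed.

Lemma normalized_table_eq0 i j : (t i j == 0) = (mu j B`_i == 0 :> R[i]).
Proof. by rewrite mulf_eq0 invr_eq0 (negPf (FPd_neq0 i)) orbF. Qed.

(** Structure constants of the rescaled basis x_i / d_i. *)
Definition normalized_const i k l : R[i] := s i k l * d l / (d i * d k).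

Lemma normalized_const_eq0 i k l :
  (normalized_const i k l == 0) = (s i k l == 0).
Proof.
by rewrite /normalized_const -mulrA mulf_eq0 mulf_eq0 invr_eq0 mulf_eq0
  !(negPf (FPd_neq0 _)) !orbF.
Qed.

(** The analogue of [weight] for the rescaled basis, since d takes equal values at [i] and
    [inv i]. *)
Definition normalized_weight i : R[i] := h i * d i ^+ 2.

Lemma row_table : character_table (ord0 : 'I_n.+1) (ord0 : 'I_n.+1)
  inv normalized_weight normalized_const t.
Proof.
split.
- exact: (ARN_invK HB).
- by move=> i; rewrite mulr_gt0 ?weight_gt0 ?exprn_gt0 ?FPd_gt0.
- move=> i k l; rewrite divr_ge0 ?mulr_ge0 ?(ARN_ge0 HB) //;
    by rewrite ltW ?FPd_gt0.
- move=> i k l; rewrite /normalized_weight /normalized_const !FPd_inv.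
  have := struct_const_reciprocal i k l.
  have := FPd_neq0 i; have := FPd_neq0 k; have := FPd_neq0 l.
  move: (h k) (h l) (d i) (d k) (d l) (s i k l) => a b c e g x g0 e0 c0 E.
  transitivity (a * x * e * g / c); first by field; rewrite c0 e0.
  by rewrite E; field; rewrite c0 g0.
- by move=> j; rewrite /t /FPd (ARN_one HB) !ahom1 divr1.
- by move=> i; rewrite /t divff ?FPd_neq0.
- move=> i k j; rewrite /t mulrACA character_mul mulr_suml -invfM.
  apply: eq_bigr => l _; rewrite /normalized_const -/(d l).
  have := FPd_neq0 l; have := FPd_neq0 i; have := FPd_neq0 k.
  by move=> *; field; apply/and3P.
- move=> i j; rewrite /t FPd_inv character_conj rmorphM fmorphV /=.
  by rewrite (CrealP (gtr0_real (FPd_gt0 i))).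
Qed.

Lemma column_inj j k : (forall i, t i j = t i k) -> j = k.
Proof.
move=> E; apply: (bij_inj (dual_bij Hmu)); apply/val_inj/lfunP => v.
rewrite (coord_sumB HB v) !linear_sum /=; apply: eq_bigr => i _.
by rewrite !linearZ /=; congr (_ *: _); rewrite [LHS]characterE E -characterE.
Qed.

Lemma dual_mul_base f g (i : 'I_n.+1) : dual_mul B mu f g B`_i =
  d i * ((f B`_i : R[i]) / d i * ((g B`_i : R[i]) / d i)) :> R[i].
Proof.
rewrite [LHS](lin_extE HB) ![f (_ *: _)]linearZ ![g (_ *: _)]linearZ /=.
by rewrite /GRing.scale /= ![(d i)^-1 * _]mulrC.
Qed.

Lemma dual_const_mul i j k :
  t i j * t i k = \sum_l dual_const B mu j k l * t i l.
Proof.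
apply: (mulfI (FPd_neq0 i)); rewrite -[LHS]dual_mul_base.
rewrite {1}(coord_basis (dual_tuple_basis HB Hmu) (memvf (dual_mul _ _ _ _))).
rewrite sum_lfunE mulr_sumr; apply: eq_bigr => l _.
rewrite scale_lfunE nth_mktuple /GRing.scale /=.
by rewrite [X in _ * X]characterE mulrCA.
Qed.

(** The squared norm of column [j], because [t (inv i) j] is the conjugate of [t i j]. *)
Definition column_norm j : R[i] :=
  \sum_i normalized_weight i * t i j * t (inv i) j.

Lemma column_norm_gt0 j : 0 < column_norm j.
Proof.
have T := row_table.
have pos i : 0 <= normalized_weight i * t i j * t (inv i) j.
  rewrite (table_conj T) -mulrA -normCK.
  by rewrite mulr_ge0 ?exprn_ge0 // ltW ?(table_gt0 T).
rewrite /column_norm (bigD1 ord0) //= ltr_wpDr ?sumr_ge0 //.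
by rewrite (Defs.inv0 HB) (table_one T) !mulr1 (table_gt0 T).
Qed.

Lemma column_orthogonality j k : j != k ->
  \sum_i normalized_weight i * t i j * t (inv i) k = 0.
Proof.
move=> ne; apply/eqP; apply: contraNT ne => nz; apply/eqP/column_inj => i.
have T := row_table.
apply: (@character_orthogonality _ _ inv normalized_weight normalized_const
  predT (t ^~ j) (t ^~ k)) => //.
- exact: (table_starK T).
- exact: (table_rec T).
- by move=> a b _ _; apply: (table_mul T).
- by move=> a b _ _; apply: (table_mul T).
Qed.

(** A Verlinde-type formula: pairing the expansion of mu_j * mu_k with column [l] isolates one
    coefficient. *)
Lemma dual_const_norm j k l : dual_const B mu j k l * column_norm l =
  \sum_i normalized_weight i * (t i j * t i k) * t (inv i) l.
Proof.
under eq_bigr => i _ do rewrite dual_const_mul mulr_sumr mulr_suml.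
rewrite exchange_big /= (bigD1 l) //= [X in _ + X]big1 ?addr0 => [|q ne].
  by rewrite /column_norm mulr_sumr; apply: eq_bigr => i _; ring.
transitivity (dual_const B mu j k q *
  \sum_i normalized_weight i * t i q * t (inv i) l).
  by rewrite mulr_sumr; apply: eq_bigr => i _; ring.
by rewrite column_orthogonality ?mulr0.
Qed.

(** The involution # is given on functionals, so an index map is chosen for it. Dualizability
    supplies [table_ge0]. *)
Lemma column_table : exists star : 'I_n.+1 -> 'I_n.+1,
  character_table (ord0 : 'I_n.+1) (ord0 : 'I_n.+1)
    star (fun l => (column_norm l)^-1) (dual_const B mu) (fun j i => t i j).
Proof.
have [star starE] := choice (dual_inv_ahom HB Hmu).
have T := row_table; exists star.
have starC j i : t i (star j) = Num.conj (t i j).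
  rewrite -(table_conj T) /t FPd_inv; congr (_ / _).
  by rewrite -[LHS]/(ahval (mu (star j)) B`_i) starE (dual_invE HB).
have norm_star j : column_norm (star j) = column_norm j.
  apply: eq_bigr => i _; rewrite !starC (table_conj T) conjCK.
  exact: mulrAC.
split=> //.
- by move=> j; apply: column_inj => i; rewrite !starC conjCK.
- by move=> j; rewrite invr_gt0 column_norm_gt0.
- move=> j k l.
  have nz q : column_norm q != 0 by rewrite gt_eqF ?column_norm_gt0.
  apply: (mulfI (nz k)); apply: (mulIf (nz l)).
  rewrite mulVKf // [RHS](_ : _ = column_norm l / column_norm l *
    (dual_const B mu (star l) j (star k) * column_norm k)); last by ring.
  (* Both sides are now the weighted sum of t i j, t i k and the conjugate of t i l, multiplied
     together. *)
  rewrite mulfV // mul1r -(norm_star k) !dual_const_norm; apply: eq_bigr => i _.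
  by rewrite !starC !(table_conj T) conjCK; ring.
- exact: (table_unit T).
- exact: (table_one T).
- by move=> j k i; apply: dual_const_mul.
Qed.

(** * Grouplike elements and unimodular rows and columns *)

Lemma characters_separate (v w : H) : (forall j, mu j v = mu j w) -> v = w.
Proof.
move=> E; rewrite (coord_sumB HB v) (coord_sumB HB w).
apply: eq_bigr => i _; congr (_ *: _).
(* The characters span the dual space, so each coordinate is a combination of them. *)
pose c : 'Hom(H, R[i]^o) := linfun (coord B i : H -> R[i]^o).
have cE x : c x = coord B i x by rewrite lfunE.
rewrite -!cE (coord_basis (dual_tuple_basis HB Hmu) (memvf c)) !sum_lfunE.
by apply: eq_bigr => j _; rewrite !scale_lfunE nth_mktuple /= E.
Qed.

(** Every character takes the value d_i^2 at x_i x_i^*, and characters separate points. *)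
Lemma grouplike_of_norm1 i : (forall j, `|t i j| = 1) -> grouplike B inv i.
Proof.
move=> n1; have E : B`_i * B`_(inv i) = (d i * d i) *: 1.
  apply: characters_separate => j; rewrite ahom_mul [RHS]ahom_scale ahom1 mulr1.
  rewrite [X in X * _]characterE [X in _ * X]characterE FPd_inv mulrACA.
  by rewrite (table_conj row_table) -normCK n1 expr1n mulr1.
rewrite /grouplike /struct_const E linearZ /= -(ARN_one HB) (coordB HB).
by rewrite eqxx mulr1.
Qed.

Lemma character_grouplike_neq0 (f : 'AHom(H, R[i]^o)) (i : 'I_n.+1) :
  grouplike B inv i -> f B`_i != 0.
Proof.
move=> gl; have := ahom_mul f B`_i B`_(inv i).
rewrite gl [X in X = _]ahom_scale ahom1 mulr1 => E.
apply: contraTneq (ARN_inv_gt0 HB i) => f0.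
by rewrite E f0 mul0r ltxx.
Qed.

Lemma dual_mul_inv_base (i j : 'I_n.+1) :
  dual_mul B mu (mu j) (dual_inv B inv (mu j)) B`_i =
  d i * `|t i j| ^+ 2 :> R[i].
Proof.
rewrite dual_mul_base (dual_invE HB) normCK -(table_conj row_table) /t.
by rewrite FPd_inv.
Qed.

Lemma dual_grouplike_of_norm1 j :
  (forall i, `|t i j| = 1) -> dual_grouplike B inv mu j.
Proof.
move=> n1; rewrite /dual_grouplike.
have -> : dual_mul B mu (mu j) (dual_inv B inv (mu j)) = mu ord0.
  apply/lfunP => v; rewrite (coord_sumB HB v) !linear_sum /=.
  apply: eq_bigr => i _; rewrite !linearZ /=; congr (_ *: _).
  by rewrite [LHS]dual_mul_inv_base n1 expr1n mulr1.
have {2}-> : ahval (mu ord0) = (dual_tuple mu)`_(ord0 : 'I_n.+1).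
  by rewrite nth_mktuple.
by rewrite coord_free ?(basis_free (dual_tuple_basis HB Hmu)) // eqxx scale1r.
Qed.

Lemma dual_grouplike_neq0 (i j : 'I_n.+1) :
  dual_grouplike B inv mu j -> mu j B`_i != 0.
Proof.
rewrite /dual_grouplike; set c := coord _ _ _ => gl.
have E k : d k * `|t k j| ^+ 2 = c * d k.
  by rewrite -dual_mul_inv_base gl scale_lfunE.
(* Evaluation at the unit gives c = 1; index [i] then gives |t i j|^2 = 1. *)
have := E ord0; rewrite (table_one row_table) normr1 expr1n mulr1.
rewrite -[X in X = _]mul1r => /(mulIf (FPd_neq0 _)) c1.
have := E i; rewrite -c1 mul1r -[RHS]mulr1 => /(mulfI (FPd_neq0 _)) ti.
rewrite -[_ == _]normalized_table_eq0; apply/negP => /eqP t0.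
by move/eqP: ti; rewrite t0 normr0 expr0n eq_sym oner_eq0.
Qed.

(** * Unimodularity from nilpotency *)

Hypothesis Hnil : nilpotent_hypergroup B inv.

Lemma normalized_sub_closed S :
  sub_closed inv s S -> sub_closed inv normalized_const S.
Proof.
case=> Sstar SM; split=> // i k l Si Sk; rewrite normalized_const_eq0.
exact: SM.
Qed.

Lemma column_unimodular j : (forall i, t i j != 0) -> forall i, `|t i j| = 1.
Proof.
move=> nz; have [star T'] := column_table; have [p Hp] := Hnil.
pose F k := indices (iter k (adjoint B inv) fullv).
suff H0 i : F 0%N i -> `|t i j| = 1 by move=> i; apply/H0/memvf.
apply: (nilpotent_unimodular row_table T' (F := F) (p := p)) => //.
- by move=> k; apply/normalized_sub_closed/indices_iter_closed.
- by move=> k _ a l Fa; rewrite normalized_const_eq0; apply: indices_ad.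
- move=> a; rewrite /F Hp => /indices_1->.
  by rewrite (table_one row_table) normr1.
Qed.

Lemma row_unimodular i : (forall j, t i j != 0) -> forall j, `|t i j| = 1.
Proof.
move=> nz; have [star T'] := column_table; have [p Hp] := Hnil.
pose F k := indices (iter k (adjoint B inv) fullv).
(* Annihilators reverse the chain: [G 0] annihilates at most the unit, so it is everything, while on
   [G p] all of t equals 1. *)
pose G k := table_perp t (F (p - k)%N).
suff H0 j : G 0%N j -> `|t i j| = 1.
  move=> j; apply: H0; apply/table_perpP => a.
  by rewrite subn0 /F Hp => /indices_1->; rewrite (table_one row_table).
apply: (nilpotent_unimodular T' row_table (F := G) (p := p)) => //.
- by move=> k; apply: (perp_closed T').
- move=> k kp; apply: (perp_ad row_table T').
  (* As k < p, [F (p - k)] is the adjoint of [F (p - k.+1)], without truncation. *)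
  rewrite -(subnSK kp) => a l Fa; rewrite normalized_const_eq0.
  exact: indices_ad.
- move=> b /table_perpP; rewrite subnn => ->; first exact: normr1.
  exact: memvf.
Qed.

End Hypergroup.

Unset Implicit Arguments.

Theorem theorem1p15 (R : realType) (H : falgType R[i]) (n : nat)
    (B : n.+1.-tuple H) (inv : 'I_n.+1 -> 'I_n.+1)
    (mu : 'I_n.+1 -> 'AHom(H, R[i]^o)) :
  ARN_hypergroup B inv ->
  dual_enumeration B mu ->
  dualizable B mu ->
  nilpotent_hypergroup B inv ->
  burnside B inv /\ dual_burnside B inv mu.
Proof.
move=> HB Hmu Hdual Hnil; split=> [i|j]; split.
- move=> [f f0] gl; move: (character_grouplike_neq0 HB f gl).
  by rewrite f0 eqxx.
- move=> ngl; apply: contrapT => nex; apply: ngl.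
  apply: (grouplike_of_norm1 HB Hmu); apply: (row_unimodular HB Hmu Hdual Hnil).
  by move=> k; rewrite (normalized_table_eq0 Hmu); apply/eqP => f0; apply: nex;
    exists (mu k).
- by move=> [i f0] gl; move: (dual_grouplike_neq0 HB Hmu i gl); rewrite f0 eqxx.
- move=> ngl; apply: contrapT => nex; apply: ngl.
  apply: (dual_grouplike_of_norm1 HB Hmu).
  apply: (column_unimodular HB Hmu Hdual Hnil).
  by move=> i; rewrite (normalized_table_eq0 Hmu); apply/eqP => f0; apply: nex;
    exists i.
Qed.
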